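(* For every pair of integers $d\ge 1$ and $p\ge 0$, there exists a graph with pathwidth at most $p+2$ which contains a distance-$(4d-1)$ half graph of order $(2d+1)^p$.
   Context: All graphs are finite, undirected and simple; $\mathrm{dist}$ is the shortest-path distance. For integers $D,\ell\ge1$, $2\ell$ pairwise distinct vertices $a_1,\dots,a_\ell,b_1,\dots,b_\ell$ of a graph form a distance-$D$ half graph of order $\ell$ if for all $i,j\in[1,\ell]$ we have $\mathrm{dist}(b_i,a_j)\le D$ if and only if $i<j$. A path decomposition of $G$ is a sequence of vertex subsets (bags) such that every edge has both endpoints in some bag and each vertex appears in a contiguous set of bags; its width is the maximum bag size minus one, and the pathwidth of $G$ is the minimum width of a path decomposition of $G$. *)

(* Defs.v *)
From mathcomp Require Import all_boot.
From mathcomp Require Import boolp.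

Set Implicit Arguments.
Unset Strict Implicit.
Unset Printing Implicit Defensive.

Record sgraph := SGraph {
  vertex :> finType;
  adj : rel vertex;
  adj_sym : symmetric adj;
  adj_irrefl : irreflexive adj
}.

Section Distance.
Variable G : sgraph.
Implicit Types x y : G.

Definition has_path x y (k : nat) : bool :=
  [exists s : k.-tuple G,
    [&& path (@adj G) x s, uniq (x :: s) & last x s == y]].

Lemma connect_has_path x y : connect (@adj G) x y -> exists k, has_path x y k.
Proof.
case/connectP=> s0 /shortenP[s s_path s_uniq _] ->.
exists (size s); apply/existsP; exists (in_tuple s).
by rewrite s_path s_uniq eqxx.
Qed.

(* None stands for infinity: x and y lie in different components. *)
Definition dist x y : option nat :=
  if @idP (connect (@adj G) x y) is ReflectT xy
  then Some (ex_minn (connect_has_path xy)) else None.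

Definition dist_le x y (D : nat) : bool :=
  if dist x y is Some k then k <= D else false.

End Distance.

(* The order l indexes the vertices by 0, ..., l - 1 instead of 1, ..., l. *)
Definition half_graph (G : sgraph) (D l : nat) (a b : 'I_l -> G) : Prop :=
  [/\ injective a, injective b, forall i j, a i != b j
    & forall i j : 'I_l, dist_le (b i) (a j) D <-> i < j].

Definition contains_half_graph (G : sgraph) (D l : nat) : Prop :=
  exists a b : 'I_l -> G, half_graph D a b.

Section Pathwidth.
Variable G : sgraph.
Implicit Type bags : seq {set G}.

(* The first clause says that the set of bags containing a given vertex is
   nonempty; it only matters for isolated vertices. *)
Definition path_decomposition bags : Prop :=
  [/\ forall x : G, exists2 B, B \in bags & x \in B,
      forall x y : G, adj x y -> exists2 B, B \in bags & (x \in B) && (y \in B)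
    & forall (x : G) (i j k : nat), i <= j <= k -> k < size bags ->
        x \in nth set0 bags i -> x \in nth set0 bags k ->
        x \in nth set0 bags j].

(* Truncated predecessor: the graph without vertices gets width 0, not -1. *)
Definition width bags : nat := (\max_(B <- bags) #|B|).-1.

Lemma path_decomposition_width_ex :
  exists w, `[< exists2 bags, path_decomposition bags & width bags = w >].
Proof.
exists (width [:: setT]); apply/asboolP; exists [:: setT] => //; split.
- by move=> x; exists setT; rewrite ?inE.
- by move=> x y _; exists setT; rewrite ?inE.
- move=> x i j [|//] /andP[_]; rewrite leqn0 => /eqP-> _ _ _.
  by rewrite inE.
Qed.

Definition pathwidth : nat := ex_minn path_decomposition_width_ex.

End Pathwidth.

(* Main.v *)
Require Import Defs.
From mathcomp Require Import all_boot.
From mathcomp Require Import boolp zify.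

Set Implicit Arguments.
Unset Strict Implicit.
Unset Printing Implicit Defensive.

(* Write i < (2d+1)^p in base 2d+1. For each level k there is one hub for every
   value of the digits above k; b_i is joined to its hub of level k by a path of
   length d + i_k, and a_j to its hub by a path of length 3d - j_k. All these
   lengths are at least d, so a path from b_i to a_j through two hubs has length
   at least 4d; through a single common hub of level k it has length
   4d + i_k - j_k, which is at most 4d - 1 iff i_k < j_k, and then i < j because
   the higher digits agree. Sweeping over the leaves and their paths in order
   takes bags made of the p current hubs, a leaf, and two consecutive vertices
   of a path. *)

(** * Distances via walks, and pathwidth via intervals *)

Section Graphs.
Variable G : sgraph.
Implicit Types x y z : G.

(** Cutting loops out of a walk never lengthens it, so walks may replace the simple paths counted by
    [dist]; walks can be concatenated freely. *)
Lemma dist_leP x y D :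
  reflect (exists s, [/\ path (@adj G) x s, last x s = y & size s <= D])
          (dist_le x y D).
Proof.
apply: (iffP idP); rewrite /dist_le /dist; case: {-}_ / idP => [xy|nxy] //.
- case: ex_minnP => k /existsP[s /and3P[s_path s_uniq /eqP s_last]] _ kD.
  by exists s; rewrite size_tuple.
- case=> t [t_path t_last tD]; case: ex_minnP => k _ k_min.
  apply: leq_trans tD; case/shortenP: t_path t_last => u u_path u_uniq u_sub u_last.
  apply: (@leq_trans (size u)).
    apply: k_min; apply/existsP; exists (in_tuple u).
    by rewrite u_path u_uniq; apply/eqP.
  by apply: uniq_leq_size u_sub; case/andP: u_uniq.
- by case=> s [xs sy _]; case: nxy; apply/connectP; exists s.
Qed.

Lemma dist_le_refl x : dist_le x x 0.
Proof. by apply/dist_leP; exists [::]. Qed.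

Lemma dist_le_adj x y : adj x y -> dist_le x y 1.
Proof. by move=> xy; apply/dist_leP; exists [:: y]; rewrite /= xy. Qed.

Lemma dist_le_trans x y z m n :
  dist_le x y m -> dist_le y z n -> dist_le x z (m + n).
Proof.
move=> /dist_leP[s [xs sy sm]] /dist_leP[t [yt tz tn]]; apply/dist_leP.
by exists (s ++ t); rewrite cat_path last_cat xs sy yt size_cat leq_add.
Qed.

Lemma dist_le_weaken x y m n : m <= n -> dist_le x y m -> dist_le x y n.
Proof.
move=> mn /dist_leP[s [xs sy sm]]; apply/dist_leP; exists s.
by split=> //; apply: leq_trans mn.
Qed.

Lemma dist_le_lipschitz (f : G -> nat) x y D :
  (forall u v, adj u v -> f v <= (f u).+1) ->
  dist_le x y D -> f y <= f x + D.
Proof.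
move=> f_lip /dist_leP[s [xs <-]]; elim: s x D xs => [|z s IHs] x D /=.
  by rewrite leq_addr.
case/andP=> xz zs; case: D => // D sD.
have := IHs z D zs sD; have := f_lip _ _ xz; lia.
Qed.

(** The bag at time [t] collects the vertices whose half-open lifespan contains [t]; contiguity
    holds because lifespans are intervals. *)
Lemma pathwidth_intervals (l r : G -> nat) w :
    (forall x, l x < r x) ->
    (forall x y, adj x y -> exists t, l x <= t < r x /\ l y <= t < r y) ->
    (forall t, #|[set x | l x <= t < r x]| <= w.+1) ->
  pathwidth G <= w.
Proof.
move=> lr_ne lr_adj lr_card.
pose bag t := [set x | l x <= t < r x].
pose T := \max_(x : G) r x.
have r_T x : r x <= T by exact: leq_bigmax.
have bag_mem x t : l x <= t < r x -> bag t \in [seq bag t | t <- iota 0 T].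
  move=> xt; apply: map_f; rewrite mem_iota; have := r_T x; lia.
have nth_bag t : t < T -> nth set0 [seq bag t | t <- iota 0 T] t = bag t.
  by move=> tT; rewrite (nth_map 0) ?size_iota // nth_iota.
rewrite /pathwidth; case: ex_minnP => m _ m_min.
apply: (@leq_trans (width [seq bag t | t <- iota 0 T])).
  apply: m_min; apply/asboolP; eexists; last by [].
  split=> [x|x y xy|x i j k /andP[ij jk]].
  - exists (bag (l x)); last by rewrite inE leqnn lr_ne.
    by apply: (bag_mem x); rewrite leqnn lr_ne.
  - have [t [xt yt]] := lr_adj x y xy.
    by exists (bag t); [apply: bag_mem xt | rewrite !inE xt yt].
  - rewrite size_map size_iota => kT; rewrite !nth_bag ?inE; lia.
rewrite /width -subn1 leq_subLR add1n; apply/bigmax_leqP_seq => B /mapP[t _ ->] _.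
exact: lr_card.
Qed.

End Graphs.

(** * Bipartite leaf-hub graphs with subdivided edges *)

Section Subdivision.
Variables (L H K : finType) (hub : L -> K -> H) (len : L -> K -> nat) (M : nat).
Hypothesis len_gt0 : forall x k, 0 < len x k.
Hypothesis len_le : forall x k, len x k <= M.

(** The uniform bound [M] on the lengths avoids an index type depending on the edge. *)
Definition subdiv_vertex : finType := (L + H + L * K * 'I_M.+1)%type.

Definition leaf_vertex (x : L) : subdiv_vertex := inl (inl x).
Definition hub_vertex (h : H) : subdiv_vertex := inl (inr h).
Definition inner_vertex (x : L) (k : K) (m : 'I_M.+1) : subdiv_vertex :=
  inr (x, k, m).

(* The vertices [inner_vertex x k m] with [m = 0] or [len x k <= m] do not
   occur here; they are isolated. *)
Definition subdiv_pos (x : L) (k : K) (m : nat) : subdiv_vertex :=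
  if m == 0 then leaf_vertex x
  else if m < len x k then inner_vertex x k (inord m)
  else hub_vertex (hub x k).

Definition subdiv_step (u v : subdiv_vertex) : bool :=
  [exists x, exists k, exists m : 'I_(len x k),
    (u == subdiv_pos x k m) && (v == subdiv_pos x k m.+1)].

Definition subdiv_adj (u v : subdiv_vertex) : bool :=
  subdiv_step u v || subdiv_step v u.

Lemma subdiv_stepP u v :
  reflect (exists x k m, [/\ m < len x k, u = subdiv_pos x k m
                                        & v = subdiv_pos x k m.+1])
          (subdiv_step u v).
Proof.
apply: (iffP existsP) => [[x /existsP[k /existsP[m /andP[/eqP-> /eqP->]]]]|].
  by exists x, k, m; split.
move=> [x [k [m [ml -> ->]]]]; exists x; apply/existsP; exists k.
by apply/existsP; exists (Ordinal ml); rewrite !eqxx.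
Qed.

Lemma subdiv_adj_sym : symmetric subdiv_adj.
Proof. by move=> u v; rewrite /subdiv_adj orbC. Qed.

Lemma subdiv_adj_irrefl : irreflexive subdiv_adj.
Proof.
move=> u; rewrite /subdiv_adj orbb; apply/negbTE/subdiv_stepP.
case=> x [k [m [ml -> /eqP]]]; apply/negP.
rewrite /subdiv_pos /=; case: ifP => [_|m0]; first by case: ifP.
rewrite ml; case: ifP => // ml'; apply/eqP => -[] /(congr1 val) /=.
by have lM := len_le x k; rewrite !inordK; lia.
Qed.

Definition subdiv_graph : sgraph := SGraph subdiv_adj_sym subdiv_adj_irrefl.

Lemma subdiv_adj_pos x k m : m < len x k ->
  @adj subdiv_graph (subdiv_pos x k m) (subdiv_pos x k m.+1).
Proof.
by move=> ml; apply/orP; left; apply/subdiv_stepP; exists x, k, m.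
Qed.

Lemma subdiv_dist_pos x k m : m <= len x k ->
  @dist_le subdiv_graph (subdiv_pos x k 0) (subdiv_pos x k m) m /\
  @dist_le subdiv_graph (subdiv_pos x k m) (subdiv_pos x k 0) m.
Proof.
elim: m => [|m IHm] ml; first by split; exact: dist_le_refl.
have [to_m from_m] := IHm (ltnW ml); have em := subdiv_adj_pos ml; split.
  rewrite -[X in dist_le _ _ X]addn1.
  by apply: (dist_le_trans to_m); apply: dist_le_adj.
rewrite -[X in dist_le _ _ X]add1n.
apply: dist_le_trans from_m; apply: dist_le_adj.
by rewrite adj_sym.
Qed.

Lemma subdiv_pos_len x k : subdiv_pos x k (len x k) = hub_vertex (hub x k).
Proof. by rewrite /subdiv_pos ltnn eqn0Ngt len_gt0. Qed.

Lemma subdiv_dist_leaves x y k k' : hub x k = hub y k' ->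
  @dist_le subdiv_graph (leaf_vertex x) (leaf_vertex y) (len x k + len y k').
Proof.
move=> xy; apply: (@dist_le_trans subdiv_graph _ (hub_vertex (hub x k))).
  by rewrite -subdiv_pos_len; case: (subdiv_dist_pos (leqnn (len x k))).
by rewrite xy -subdiv_pos_len; case: (subdiv_dist_pos (leqnn (len y k'))).
Qed.

(* A potential on leaves and hubs that respects the lengths of the subdivided
   edges extends to a 1-Lipschitz function on the whole graph. *)
Lemma subdiv_dist_potential (fL : L -> nat) (fH : H -> nat) x y D :
    (forall z k, fL z <= fH (hub z k) + len z k) ->
    (forall z k, fH (hub z k) <= fL z + len z k) ->
    @dist_le subdiv_graph (leaf_vertex x) (leaf_vertex y) D ->
  fL y <= fL x + D.
Proof.
move=> fLH fHL.
pose f (u : subdiv_graph) : nat := match u with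
  | inl (inl z) => fL z
  | inl (inr h) => fH h
  | inr (z, k, m) => minn (fL z + m) (fH (hub z k) + (len z k - m))
  end.
have f_pos z k m : m <= len z k ->
    f (subdiv_pos z k m) = minn (fL z + m) (fH (hub z k) + (len z k - m)).
  move=> ml; have LH := fLH z k; have HL := fHL z k; have lM := len_le z k.
  rewrite /subdiv_pos; case: eqP => [->|m0] /=; first lia.
  by case: ifP => ml' /=; [rewrite inordK; lia | lia].
apply: (@dist_le_lipschitz subdiv_graph f) => u v.
case/orP => /subdiv_stepP[z [k [m [ml -> ->]]]].
  by rewrite !f_pos; lia.
by rewrite !f_pos; lia.
Qed.

End Subdivision.

(** * Euclidean division and base-[B] digits *)

Lemma divn_eqP W a t : 0 < W -> (a * W <= t < a.+1 * W) = (t %/ W == a).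
Proof. by move=> W0; rewrite -leq_divRL // -ltn_divLR // ltnS eqn_leq andbC. Qed.

Lemma mixed_radix_inj W a b m n : m < W -> n < W ->
  a * W + m = b * W + n -> a = b /\ m = n.
Proof.
move=> mW nW e; have W0 : 0 < W by lia.
have ab : a = b.
  by have := congr1 (divn^~ W) e; rewrite !divnMDl // !divn_small // !addn0.
by split=> //; move: e; rewrite ab; lia.
Qed.

Section Digits.
Variable B : nat.
Hypothesis B_gt0 : 0 < B.

Definition digit (i k : nat) : nat := (i %/ B ^ k) %% B.

Lemma digit_lt i k : digit i k < B.
Proof. exact: ltn_pmod. Qed.

Lemma divn_expS i k : i %/ B ^ k = i %/ B ^ k.+1 * B + digit i k.
Proof. by rewrite expnSr divnMA -divn_eq. Qed.

Lemma digit_le i j k : j <= i -> i %/ B ^ k.+1 = j %/ B ^ k.+1 ->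
  digit j k <= digit i k.
Proof.
move=> ji e; have := leq_div2r (B ^ k) ji.
by rewrite (divn_expS i) (divn_expS j) e leq_add2l.
Qed.

Lemma digit_lt_ex p i j : i < j -> j < B ^ p ->
  exists2 k, k < p & i %/ B ^ k.+1 = j %/ B ^ k.+1 /\ digit i k < digit j k.
Proof.
move=> ij jp.
(* Take the least number of low digits whose removal makes [i] and [j] agree. It is positive since
   [i < j], and the last digit removed is the highest one where they differ. *)
have ex : exists k, i %/ B ^ k == j %/ B ^ k.
  by exists p; rewrite !divn_small //; lia.
case: (ex_minnP ex) => -[|k] /eqP e k_min; first by move: e; rewrite !divn1; lia.
exists k.
  by apply: k_min; rewrite !divn_small //; lia.
split=> //; have := leq_div2r (B ^ k) (ltnW ij).
have : i %/ B ^ k != j %/ B ^ k by apply/negP => /k_min; rewrite ltnn.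
rewrite (divn_expS i) (divn_expS j) e; lia.
Qed.

End Digits.

(** * The hub graph and its half graph *)

Section Construction.
Variables d p : nat.
Hypothesis d_gt0 : 0 < d.

Local Notation B := (2 * d + 1).
Local Notation N := (B ^ p).

Let B_gt0 : 0 < B. Proof. by rewrite addn1. Qed.

(* [(i, false)] stands for b_i and [(i, true)] for a_i. *)
Local Notation leaf := ('I_N * bool)%type.

Lemma prefix_subproof (i : 'I_N) k : i %/ B ^ k < N.
Proof. exact: leq_ltn_trans (leq_div _ _) (ltn_ord i). Qed.

(** Prefixes at every level are stored in ['I_N], a crude bound independent of [k]; the surplus hubs
    are isolated. *)
Definition prefix_hub (x : leaf) (k : 'I_p) : 'I_p * 'I_N :=
  (k, Ordinal (prefix_subproof x.1 k.+1)).

(** The base is [2 * d + 1] because [3 * d - digit] must stay at least [d], which allows digits up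
    to [2 * d]. *)
Definition link_length (x : leaf) (k : 'I_p) : nat :=
  if x.2 then 3 * d - digit B x.1 k else d + digit B x.1 k.

Lemma link_length_bounds x k : d <= link_length x k <= 3 * d.
Proof. by have := digit_lt B_gt0 x.1 k; rewrite /link_length; case: ifP; lia. Qed.

Lemma link_length_gt0 x k : 0 < link_length x k.
Proof. by have := link_length_bounds x k; lia. Qed.

Lemma link_length_le x k : link_length x k <= 3 * d.
Proof. by have := link_length_bounds x k; lia. Qed.

Definition hub_tree : sgraph := subdiv_graph prefix_hub link_length_le.

Lemma hub_tree_half_graph : contains_half_graph hub_tree (4 * d - 1) N.
Proof.
exists (fun i => leaf_vertex _ _ _ (i, true)).
exists (fun i => leaf_vertex _ _ _ (i, false)).
split; [by move=> i j [] | by move=> i j [] | by move=> i j; apply/eqP | move=> i j].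
split=> [ij|ij]; last first.
  have [k kp [e lt_digit]] := digit_lt_ex B_gt0 ij (ltn_ord j).
  have hub_ij :
      prefix_hub (i, false) (Ordinal kp) = prefix_hub (j, true) (Ordinal kp).
    by congr (_, _); apply: val_inj.
  apply: dist_le_weaken
    (subdiv_dist_leaves link_length_gt0 link_length_le hub_ij).
  by have := digit_lt B_gt0 j k; rewrite /link_length /=; lia.
rewrite ltnNge; apply/negP => ji.
(* This potential rises from 0 at b_i to [4 * d] at every a_j with j <= i. Hubs of b_i get their
   distance [d + i_k], which lies in [d, 3d]; the neutral value [2 * d] of other leaves is within
   [d] of every hub value. At a hub shared with a_j the digit inequality j_k <= i_k gives the
   required bound. *)
pose fL (x : leaf) : nat :=
  if x == (i, false) then 0 else if x.2 && (x.1 <= i) then 4 * d else 2 * d.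
pose fH (h : 'I_p * 'I_N) : nat :=
  if h.2 == i %/ B ^ h.1.+1 :> nat then d + digit B i h.1 else 3 * d.
have fLH (x : leaf) (k : 'I_p) : fL x <= fH (prefix_hub x k) + link_length x k.
  have := link_length_bounds x k; case: x => z s; rewrite /fL /fH /=.
  case: eqP => [//|_]; case: ifP => [/andP[-> zi]|_]; last by case: ifP => _; lia.
  rewrite /link_length /=; case: eqP => [e|_]; last by lia.
  by have := digit_le zi (esym e); have := digit_lt B_gt0 z k; lia.
have fHL (x : leaf) (k : 'I_p) : fH (prefix_hub x k) <= fL x + link_length x k.
  have := link_length_bounds x k; have := digit_lt B_gt0 i k.
  case: x => z s; rewrite /fL /fH /=; case: (_ =P (i, false)) => [[-> ->]|_].
    by rewrite eqxx.
  by case: ifP => _; case: ifP => _; lia.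
have := subdiv_dist_potential fLH fHL ij.
by rewrite /fL /= eqxx ji; case: eqP => // _; lia.
Qed.

(** * Lifespans and the pathwidth bound *)

Let M := (3 * d).+1.
(** One slot more than the [p] levels keeps blocks nonempty when [p] is 0. *)
Let W := p.+1 * M.
Let M_gt0 : 0 < M. Proof. by []. Qed.
Let W_gt0 : 0 < W. Proof. by rewrite muln_gt0. Qed.

(* Time is cut into blocks of length [W], one for each leaf; inside the block of
   a leaf, the path to its hub of level [k] is swept during [kM, (k+1)M). *)
Definition block (x : leaf) : nat := x.1 * 2 + x.2.
Definition inner_time (x : leaf) (k : 'I_p) (m : nat) : nat :=
  (block x * p.+1 + k) * M + m.
(** A prefix above level [k] is shared by [B ^ k.+1] consecutive indices, each owning two blocks. *)
Definition hub_span (k : 'I_p) : nat := W * 2 * B ^ k.+1.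

Definition start_time (u : hub_tree) : nat := match u with
  | inl (inl x) => block x * W
  | inl (inr h) => h.2 * hub_span h.1
  | inr (x, k, m) => inner_time x k m
  end.
(** An inner vertex lives for two time units, so that it overlaps with its successor on the path. *)
Definition end_time (u : hub_tree) : nat := match u with
  | inl (inl x) => (block x).+1 * W
  | inl (inr h) => h.2.+1 * hub_span h.1
  | inr (x, k, m) => (inner_time x k m).+2
  end.

Let hub_span_gt0 k : 0 < hub_span k.
Proof. by rewrite !muln_gt0 expn_gt0 B_gt0. Qed.

Lemma block_inj : injective block.
Proof.
move=> [i s] [j t]; rewrite /block /= => e.
have [/val_inj-> st] : i = j :> nat /\ s = t :> nat.
  by apply: (@mixed_radix_inj 2) e; rewrite ltnS leq_b1.
by congr (_, _); case: s t st {e} => [] [].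
Qed.

Lemma inner_time_block x k m : m < M -> inner_time x k m %/ W = block x.
Proof.
move=> mM; rewrite /inner_time /W [p.+1 * M]mulnC divnMA divnMDl //.
by rewrite (divn_small mM) addn0 divnMDl // divn_small ?addn0 // ltnS ltnW.
Qed.

Lemma inner_time_inj x y k l m n : m < M -> n < M ->
  inner_time x k m = inner_time y l n -> [/\ x = y, k = l & m = n].
Proof.
move=> mM nM /(mixed_radix_inj mM nM)[e ->].
have kp (k' : 'I_p) : k' < p.+1 by rewrite ltnS ltnW.
by have [/block_inj-> /val_inj->] := mixed_radix_inj (kp k) (kp l) e.
Qed.

Lemma active_pos x k m t : m <= link_length x k ->
    t < M -> m <= t <= m + (m < link_length x k) ->
  let u := subdiv_pos prefix_hub link_length (3 * d) x k m in
  start_time u <= inner_time x k t < end_time u.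
Proof.
move=> ml tM mt; have bt := inner_time_block x k tM.
rewrite /subdiv_pos; case: eqP => [m0|_] /=.
  by rewrite divn_eqP // bt.
case: ifP => ml'; rewrite /=.
  by have lM := link_length_le x k; rewrite inordK /inner_time; lia.
rewrite divn_eqP // /hub_span divnMA divnMA bt.
by rewrite /block divnMDl // [x.2 %/ 2]divn_small ?ltnS ?leq_b1 // addn0.
Qed.

Lemma hub_tree_pathwidth : pathwidth hub_tree <= p + 2.
Proof.
apply: (@pathwidth_intervals _ start_time end_time).
- move=> [[x|h]|[[x k] m]] //=; rewrite ltn_mul2r ?W_gt0 ?hub_span_gt0 ltnS; lia.
- have step_active u v : subdiv_step prefix_hub link_length u v ->
      exists t, start_time u <= t < end_time u /\ start_time v <= t < end_time v.
    case/subdiv_stepP => x [k [m [ml -> ->]]]; exists (inner_time x k m.+1).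
    have := link_length_le x k.
    by split; apply: active_pos; lia.
  move=> u v /orP[/step_active//|/step_active[t [tv tu]]].
  by exists t.
move=> t.
(* A bag has at most one leaf, one hub per level and two inner vertices, namely those starting at
   [t] and at [t - 1]; hence [p + 3] codes. *)
pose code (u : hub_tree) : option 'I_p + bool := match u with
  | inl (inl x) => inl None
  | inl (inr h) => inl (Some h.1)
  | inr (x, k, m) => inr (inner_time x k m == t)
  end.
have code_inj : {in [set u | start_time u <= t < end_time u] &, injective code}.
  move=> [[x|h]|[[x k] m]] [[y|g]|[[y l] n]]; rewrite !inE //=.
  - rewrite !divn_eqP // => /eqP e1 /eqP e2 _.
    by rewrite (block_inj (etrans (esym e1) e2)).
  - case: h g => [k q] [l r] /=; rewrite !divn_eqP // => /eqP e1 /eqP e2 [kl].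
    by move: e1; rewrite kl e2 => /val_inj ->.
  - move=> e1 e2 [e]; have e3 : inner_time x k m = inner_time y l n by lia.
    by have [-> -> /val_inj->] := inner_time_inj (ltn_ord m) (ltn_ord n) e3.
rewrite -(card_in_imset code_inj); apply: leq_trans (max_card _) _.
by rewrite card_sum card_option card_ord card_bool addSn.
Qed.

End Construction.

Theorem theorem3p6 (d p : nat) (hd : 1 <= d) :
  exists G : sgraph,
    pathwidth G <= p + 2 /\
    contains_half_graph G (4 * d - 1) ((2 * d + 1) ^ p).
Proof.
exists (hub_tree p hd); split.
  exact: hub_tree_pathwidth.
exact: hub_tree_half_graph.
Qed.
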